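(* Let $\{X_k\}_{k\in\mathbb{N}}$, $\mu$, $(\mathcal{F}_k)$, $\{m(t)\}$, $M(t)$, $\mu(t)$, $v_0^2(t)$ be as described in the context, with all standing assumptions listed there, and let the conditional and empirical batch variances be $$v_1^2(t):=\frac{1}{|M(t)|}\sum_{k\in M(t)}\mathrm{Var}_{k-1}(X_k),\qquad v_2^2(t):=\frac{1}{|M(t)|-1}\sum_{k\in M(t)}\left(X_k-\mu(t)\right)^2 .$$ Suppose that $\mathbb{P}_0$-a.s. $\inf_{t\in\mathbb{N}}v_1^2(t)>0$ and $\sup_{t\in\mathbb{N}}v_1^2(t)<+\infty$, that $v_1^2(t)/v_0^2(t)\to1$ in $\mathbb{P}_0$-probability as $t\to+\infty$, and that for every $\eta>0$, $$\frac{1}{|M(t)|}\sum_{k\in M(t)}\mathbb{E}_{k-1}\left[|X_k-\mu|^2\mathbf{1}\left(|X_k-\mu|>\eta\sqrt{|M(t)|}\right)\right]\to0\quad\text{in }\mathbb{P}_0\text{-probability as }t\to+\infty.$$ Suppose in addition that $$\limsup_{k\to+\infty}\mathbb{E}_0\left[|X_k|^4\right]<+\infty\qquad\text{and}\qquad \lim_{t\to+\infty}\frac{1}{|M(t)|}\sum_{k\in M(t)}\left(X_k^2-\mathbb{E}_{k-1}[X_k^2]\right)=0\quad\mathbb{P}_0\text{-a.s.}$$ Then $$\frac{v_2^2(t)}{v_1^2(t)}\to1\quad\text{in }\mathbb{P}_0\text{-probability as }t\to+\infty.$$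
   Context: Notation and setting. $\mathbb{N}=\{1,2,\dots\}$, $\mathbb{N}_0=\{0,1,2,\dots\}$. $\{X_k\}_{k\in\mathbb{N}}$ is a sequence of real random variables on a filtered probability space $(\Omega,\mathcal{F},(\mathcal{F}_k)_{k\in\mathbb{N}_0},\mathbb{P})$, where $\mathcal{F}_0$ is the (trivial) $\sigma$-field generated by the $\mathbb{P}$-null sets; the filtration need not be the one generated by $\{X_k\}$. Write $\mathbb{P}_k(\cdot)=\mathbb{P}(\cdot|\mathcal{F}_k)$, $\mathbb{E}_k[\cdot]=\mathbb{E}[\cdot|\mathcal{F}_k]$, $\mathrm{Var}_k(\cdot)=\mathrm{Var}(\cdot|\mathcal{F}_k)$; in particular $\mathbb{P}_0,\mathbb{E}_0,\mathrm{Var}_0$ are in effect unconditional. $\mathbf{1}(D)$ is the indicator of $D$; $f(t)\sim g(t)$ means $f(t)/g(t)\to1$. Batches. $\{m(t)\}_{t\in\mathbb{N}_0}$ is a deterministic sequence of non-negative integers with $m(0)=0$ and $m(t)>m(t-1)$ for all $t\in\mathbb{N}$; $M(t):=\{m(t-1)+1,\dots,m(t)\}$ and $|M(t)|=m(t)-m(t-1)$. The empirical batch mean is $\mu(t):=|M(t)|^{-1}\sum_{k\in M(t)}X_k$, and the theoretical batch variance is $v_0^2(t):=|M(t)|\mathrm{Var}_0(\mu(t))=|M(t)|^{-1}\sum_{k\in M(t)}\mathrm{Var}_0(X_k)$. The quantity $v_2^2(t)$ is considered for $t$ with $|M(t)|\ge2$ (all large $t$). Standing assumptions. (1) For every $k\in\mathbb{N}$,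 $X_k$ is $\mathcal{F}_k$-measurable and $\mathbb{E}_{k-1}[X_k]=\mu$ for some constant $\mu\in\mathbb{R}$. (2) $|M(t)|\to+\infty$ as $t\to+\infty$. (3) $\inf_{t\in\mathbb{N}}v_0^2(t)>0$, $\sup_{t\in\mathbb{N}}v_0^2(t)<+\infty$, and $v_0^2(t+1)/|M(t+1)|\sim v_0^2(t)/|M(t)|$ as $t\to+\infty$. *)

(* Defs.v *)
From HB Require Import structures.
From mathcomp Require Import all_boot all_order all_algebra.
From mathcomp Require Import all_classical all_reals all_analysis.
From mathcomp Require Import measurable_realfun.

Set Implicit Arguments.
Unset Strict Implicit.
Unset Printing Implicit Defensive.

Import Order.TTheory GRing.Theory Num.Theory.
Import numFieldNormedType.Exports.

Local Open Scope classical_set_scope.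
Local Open Scope ring_scope.

Section conditional_expectation.
Context d (T : measurableType d) (R : realType) (P : probability T R).
Implicit Types (G : set (set T)) (X Y : T -> R).

Definition measurable_wrt G X :=
  measurable_fun [set: g_sigma_algebraType G] (X : g_sigma_algebraType G -> R).

Definition is_condexp G X Y := [/\
  measurable_wrt G Y,
  P.-integrable setT (EFin \o Y) &
  forall A, G A ->
    (\int[P]_(w in A) (Y w)%:E = \int[P]_(w in A) (X w)%:E)%E].

(* A version of E[X | G], determined up to a P-null set of G; it exists for
   every integrable X (condexpP below) and is 0 when there is no version. *)
Definition condexp G X : T -> R := xget (cst 0) (is_condexp G X).

Definition condvar G X : T -> R :=
  condexp G (fun w => (X w - condexp G X w) ^+ 2).

Lemma condexp_exists G X : sigma_algebra setT G -> G `<=` measurable ->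
  P.-integrable setT (EFin \o X) -> exists Y, is_condexp G X Y.
Proof.
move=> sG GT iX.
pose U : measurableType (sigma_display G) := g_sigma_algebraType G.
have mE : (measurable : set (set U)) = G by exact: measurable_g_measurableTypeE.
pose toU : T -> U := id.
have mtoU : measurable_fun setT toU by move=> _ A; rewrite mE setTI => /GT.
pose toUf : {mfun T >-> U} := mfun_Sub (mem_set mtoU).
pose PU : probability U R := distribution P toUf.
pose nu' := pushforward (induced_charge iX) toU : {charge set U -> \bar R}.
pose nu := nu' mtoU.
have nuPU : nu `<< PU.
  apply/null_content_dominatesP => A; rewrite mE => GA PA0.
  rewrite /nu/= /nu'/= /pushforward /induced_charge; apply: null_set_integral => //.
  - exact: GT.
  - exact: (measurable_funS _ (@subsetT _ _) (measurable_int _ iX)).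
pose f : U -> \bar R := Radon_Nikodym nu PU.
have ffin u : f u \is a fin_num by exact: Radon_Nikodym_fin_num.
have intf : PU.-integrable setT f by exact: Radon_Nikodym_integrable.
have fE A : measurable A -> nu A = (\int[PU]_(u in A) f u)%E.
  exact: Radon_Nikodym_integral.
have mf : measurable_fun setT f by exact: measurable_int intf.
have fineE : EFin \o (fine \o f) = f.
  by apply/funext => x /=; rewrite fineK.
have intfT : P.-integrable setT (f \o toU).
  apply/integrableP; split; first exact: measurableT_comp.
  case/integrableP : intf => _; apply: le_lt_trans.
  rewrite (@ge0_integral_pushforward _ _ _ _ _ _ mtoU)//.
  exact: measurableT_comp.
exists (fine \o f); split.
- by apply: measurableT_comp => //; exact: measurable_fine.
- by rewrite fineE.
- move=> A GA.
  transitivity (nu A); last by [].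
  rewrite fE ?mE// (integral_pushforward mtoU) ?mE//.
  + by apply: eq_integral => x _; rewrite /= fineK.
  + by apply: integrableS intfT => //; exact: GT.
Qed.

Lemma condexpP G X : sigma_algebra setT G -> G `<=` measurable ->
  P.-integrable setT (EFin \o X) -> is_condexp G X (condexp G X).
Proof. by move=> sG GT iX; apply: xgetPex; exact: condexp_exists. Qed.

Definition null_sigma_algebra : set (set T) :=
  <<s [set N | measurable N /\ P N = 0%E] >>.

Definition is_filtration (F : nat -> set (set T)) := [/\
  F 0%N = null_sigma_algebra,
  forall k, sigma_algebra setT (F k),
  forall k, F k `<=` measurable &
  forall k, F k `<=` F k.+1].

Definition cvg_in_prob (Y : nat -> T -> R) (l : R) :=
  forall e : R, 0 < e ->
    P [set w | e < `|Y t w - l|] @[t --> \oo] --> 0%E.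

End conditional_expectation.

(* A batch M(t) is the index interval m (t - 1) < k <= m t; only t >= 1 and
   k >= 1 are meaningful below. *)
Definition batch_size (m : nat -> nat) (t : nat) : nat := (m t - m t.-1)%N.

Section batches.
Context d (T : measurableType d) (R : realType) (P : probability T R).
Variables (F : nat -> set (set T)) (X : nat -> T -> R) (m : nat -> nat).

Definition batch_avg (Z : nat -> R) (t : nat) : R :=
  (batch_size m t)%:R^-1 * \sum_((m t.-1).+1 <= k < (m t).+1) Z k.

Definition batch_mean (t : nat) (w : T) : R := batch_avg (X ^~ w) t.

Definition v0sq (t : nat) : \bar R :=
  ((batch_size m t)%:R%:E * 'V_P[batch_mean t])%E.

Definition v1sq (t : nat) (w : T) : R :=
  batch_avg (fun k => condvar P (F k.-1) (X k) w) t.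

Definition v2sq (t : nat) (w : T) : R :=
  ((batch_size m t)%:R - 1)^-1 *
  \sum_((m t.-1).+1 <= k < (m t).+1) (X k w - batch_mean t w) ^+ 2.

End batches.

(* Main.v *)
Require Import Defs.
From HB Require Import structures.
From mathcomp Require Import all_boot all_order all_algebra.
From mathcomp Require Import all_classical all_reals all_analysis.
From mathcomp Require Import measurable_realfun.
From mathcomp Require Import ring lra.

Set Implicit Arguments.
Unset Strict Implicit.

Import Order.TTheory GRing.Theory Num.Theory.
Import numFieldNormedType.Exports.

Local Open Scope classical_set_scope.
Local Open Scope ring_scope.

(** Write n for the size of the batch, D for the deviation of the batch mean
from mu, and S for the batch average of X_k^2 - E_(k-1)[X_k^2]. Since
E_(k-1)[X_k] = mu, the conditional variance Var_(k-1)(X_k) is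
E_(k-1)[X_k^2] - mu^2 (condvarE), so that v1 is, up to S, the empirical second
moment of the batch minus mu^2 (v1sqE_ae), whereas v2 is n / (n - 1) times the
difference between the empirical second moment and the squared batch mean
(sumsq_dev). The empirical
second moment cancels out of the comparison (ratio_identity):

  v2 / v1 - 1 = n / (n - 1) * (S - 2 mu D - D^2) / v1 + 1 / (n - 1).

The right-hand side is small with high probability (ratio_bound), for three
reasons.
- S tends to 0 almost surely, hence in probability (ae_cvg_in_prob).
- The variance of the batch mean is v0 / n with v0 bounded, so Chebyshev's
  inequality makes D tend to 0 in probability (batch_mean_cvg_in_prob).
- v0 is at least some constant c > 0 and v1 / v0 tends to 1 in probability, so
  v1 >= c / 2 with high probability.

The bound on fourth moments serves to make X_k^2 integrable for large k, which
is what gives E_(k-1)[X_k^2] its meaning; batches start at arbitrarily large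
indices, so the finitely many exceptional k do not matter. Conditional
expectations are measurable even for those k (condexp_measurable), hence all the
events below are measurable for every t. *)

(** * Uniqueness and linearity of conditional expectations *)

Section condexp_theory.
Context d (T : measurableType d) (R : realType) (P : probability T R).
Context (G : set (set T)) (sG : sigma_algebra setT G) (GT : G `<=` measurable).
Implicit Types X Y : T -> R.

Lemma measurable_wrt_sub Y : measurable_wrt G Y -> measurable_fun setT Y.
Proof.
move=> mY _ B mB; apply: GT.
by have := mY measurableT B mB; rewrite measurable_g_measurableTypeE.
Qed.

(** [condexp] is either a version or the constant 0, so non-integrable X are
covered as well. *)
Lemma condexp_measurable X : measurable_fun setT (condexp P G X).
Proof.
rewrite /condexp; case: xgetP => [Y _ [mY _ _]|_]; last exact: measurable_cst.
exact: measurable_wrt_sub.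
Qed.

(** The event on which Y2 < Y1 belongs to G, so both versions have the same
integral on it; a positive function with zero integral lives on a null set. *)
Lemma is_condexp_le X Y1 Y2 : is_condexp P G X Y1 -> is_condexp P G X Y2 ->
  \forall w \ae P, Y1 w <= Y2 w.
Proof.
move=> [mY1 iY1 Y1E] [mY2 iY2 Y2E].
pose A := [set w | Y2 w < Y1 w].
have GA : G A.
  have := measurable_fun_ltr mY2 mY1 measurableT (_ : measurable [set true]).
  by rewrite measurable_g_measurableTypeE// setTI; apply.
have mA := @GT _ GA.
have iA Y : P.-integrable setT (EFin \o Y) -> P.-integrable A (EFin \o Y).
  by move=> iY; exact: integrableS iY.
have mD : measurable_fun A (EFin \o (Y1 \- Y2)).
  apply/measurable_EFinP; apply: measurable_funB;
    apply: measurable_funTS; exact: measurable_wrt_sub.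
have D0 : (\int[P]_(w in A) `|(EFin \o (Y1 \- Y2)%R) w| = 0)%E.
  transitivity (\int[P]_(w in A) ((Y1 w)%:E - (Y2 w)%:E))%E.
    apply: eq_integral => w /set_mem Aw /=.
    by rewrite ger0_norm ?EFinB// subr_ge0 ltW.
  rewrite integralB//; [|exact: iA|exact: iA].
  rewrite Y1E// -Y2E// subee//.
  by apply: integrable_fin_num => //; exact: iA.
have := (ae_eq_integral_abs P mA mD).1 D0.
apply: filterS => w /= AD; rewrite leNgt; apply/negP => Aw.
by have /eqP := AD Aw; rewrite eqe subr_eq0 gt_eqF.
Qed.

Lemma is_condexp_unique X Y1 Y2 : is_condexp P G X Y1 -> is_condexp P G X Y2 ->
  \forall w \ae P, Y1 w = Y2 w.
Proof.
move=> h1 h2; have := is_condexp_le h1 h2; have := is_condexp_le h2 h1.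
by apply: filterS2 => w le21 le12; apply/eqP; rewrite eq_le le12.
Qed.

Lemma is_condexp_cst c : is_condexp P G (cst c) (cst c).
Proof.
split=> //; first exact: measurable_cst.
exact: finite_measure_integrable_cst.
Qed.

Lemma is_condexp_lin a X1 X2 Y1 Y2 :
  P.-integrable setT (EFin \o X1) -> P.-integrable setT (EFin \o X2) ->
  is_condexp P G X1 Y1 -> is_condexp P G X2 Y2 ->
  is_condexp P G (fun w => X1 w + a * X2 w) (fun w => Y1 w + a * Y2 w).
Proof.
move=> iX1 iX2 [mY1 iY1 Y1E] [mY2 iY2 Y2E].
have lin A Z1 Z2 : measurable A -> P.-integrable setT (EFin \o Z1) ->
    P.-integrable setT (EFin \o Z2) ->
    (\int[P]_(w in A) (Z1 w + a * Z2 w)%:E =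
     \int[P]_(w in A) (Z1 w)%:E + a%:E * \int[P]_(w in A) (Z2 w)%:E)%E.
  move=> mA iZ1 iZ2.
  have iA Z : P.-integrable setT (EFin \o Z) -> P.-integrable A (EFin \o Z).
    by move=> iZ; exact: integrableS iZ.
  under eq_integral do rewrite EFinD EFinM.
  rewrite integralD//; [|exact: iA|apply: integrableZl => //; exact: iA].
  by rewrite integralZl//; exact: iA.
split.
- by apply: measurable_funD => //; apply: measurable_funM.
- rewrite (_ : EFin \o _ = (EFin \o Y1) \+ (fun w => a%:E * (Y2 w)%:E))%E//.
  by apply: integrableD => //; exact: integrableZl.
- by move=> A GA; have mA := @GT _ GA; rewrite !lin// Y1E// Y2E.
Qed.

(** Lets the random centering E[X | G] in [condvar] be replaced by the constant
mu, which it equals only almost surely. *)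
Lemma is_condexp_ae X X' Y :
  measurable_fun setT X -> measurable_fun setT X' ->
  (\forall w \ae P, X w = X' w) -> is_condexp P G X Y -> is_condexp P G X' Y.
Proof.
move=> mX mX' XX' [mY iY YE]; split=> // A GA.
rewrite YE//; have mA := @GT _ GA.
apply: ae_eq_integral => //.
- by apply/measurable_EFinP; exact: measurable_funTS.
- by apply/measurable_EFinP; exact: measurable_funTS.
- by move: XX'; apply: filterS => w -> .
Qed.

Lemma condexp_int X : P.-integrable setT (EFin \o X) ->
  (\int[P]_w (condexp P G X w)%:E = \int[P]_w (X w)%:E)%E.
Proof.
move=> iX; have [_ _ ->//] := condexpP sG GT iX.
by have [G0 GD _] := sG; rewrite -(setD0 setT); exact: GD.
Qed.

(** Expand (X - mu)^2 and condition term by term; the cross term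
- 2 mu E[X | G] and the constant mu^2 add up to - mu^2. *)
Lemma condvarE X mu :
  P.-integrable setT (EFin \o X) ->
  P.-integrable setT (EFin \o (fun w => X w ^+ 2)) ->
  (\forall w \ae P, condexp P G X w = mu) ->
  \forall w \ae P, condvar P G X w = condexp P G (fun w => X w ^+ 2) w - mu ^+ 2.
Proof.
move=> iX iX2 Xmu.
have mX : measurable_fun setT X by apply/measurable_EFinP; exact: measurable_int iX.
have c1 := condexpP sG GT iX.
have c2 := condexpP sG GT iX2.
have ic c : P.-integrable setT (EFin \o cst c : T -> \bar R).
  exact: finite_measure_integrable_cst.
have iX2c : P.-integrable setT (EFin \o (fun w => X w ^+ 2 + 1 * cst (mu ^+ 2) w)).
  rewrite (_ : EFin \o _ =
    (EFin \o (fun w => X w ^+ 2)%R) \+ (EFin \o cst (mu ^+ 2)%R))%E.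
    exact: integrableD.
  by apply/funext => w /=; rewrite mul1r.
have c3 := is_condexp_lin (- (2 * mu)) iX2c iX
  (is_condexp_lin 1 iX2 (ic _) c2 (is_condexp_cst _)) c1.
have c4 : is_condexp P G (fun w => (X w - condexp P G X w) ^+ 2)
    (fun w => condexp P G (fun w => X w ^+ 2) w + 1 * cst (mu ^+ 2) w
              + - (2 * mu) * condexp P G X w).
  move: c3; apply: is_condexp_ae.
  - apply: measurable_funD; last exact: measurable_funM.
    by apply: measurable_funD; [exact: (measurable_funX 2 mX)|exact: measurable_funM].
  - by apply: measurable_funX; apply: measurable_funB => //; exact: condexp_measurable.
  - by move: Xmu; apply: filterS => w -> /=; ring.
(* [condexp] picks a version as soon as one exists, and [c4] exhibits one. *)
have c5 : is_condexp P G (fun w => (X w - condexp P G X w) ^+ 2) (condvar P G X).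
  by apply: xgetPex; eexists; exact: c4.
have := is_condexp_unique c5 c4; move: Xmu; apply: filterS2 => w -> -> /=.
by ring.
Qed.

End condexp_theory.

(** * Convergence in probability *)

Section convergence_in_probability.
Context d (T : measurableType d) (R : realType) (P : probability T R).

Lemma measurable_dev (Y : T -> R) (l e : R) : measurable_fun setT Y ->
  measurable [set w | e < `|Y w - l|].
Proof.
move=> mY; rewrite -[X in measurable X]setTI; apply: measurable_fun_ltr => //.
by apply: measurableT_comp => //; exact: measurable_funB.
Qed.

Lemma cvg_prob_setU (A B : nat -> set T) :
  (forall t, measurable (A t)) -> (forall t, measurable (B t)) ->
  P (A t) @[t --> \oo] --> 0%E -> P (B t) @[t --> \oo] --> 0%E ->
  P (A t `|` B t) @[t --> \oo] --> 0%E.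
Proof.
move=> mA mB A0 B0.
apply: (@squeeze_cvge _ _ _ _ (cst 0%E) _ (fun t => P (A t) + P (B t))%E).
- by apply: nearW => t; rewrite measure_ge0/= measureU2.
- exact: cvg_cst.
- by rewrite -[X in _ --> X]adde0; apply: cvgeD.
Qed.

(** Convergence in probability can be checked on exceptional events B t that may
depend on e and that control the deviation up to a null set depending on t. *)
Lemma cvg_in_prob_ae_sub (Y : nat -> T -> R) l :
  (forall t, measurable_fun setT (Y t)) ->
  (forall e, 0 < e -> exists B : nat -> set T,
    [/\ forall t, measurable (B t), P (B t) @[t --> \oo] --> 0%E &
        \forall t \near \oo, \forall w \ae P, e < `|Y t w - l| -> B t w]) ->
  cvg_in_prob P Y l.
Proof.
move=> mY YB e e0; have [B [mB B0 YB']] := YB e e0.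
apply: (@squeeze_cvge _ _ _ _ (cst 0%E) _ (fun t => P (B t))) => //; last exact: cvg_cst.
move: YB'; apply: filterS => t [N [mN N0 YN]].
have mYe : measurable [set w | e < `|Y t w - l|] by exact: measurable_dev.
rewrite measure_ge0/= -(measureU0 (mB t) mN N0).
apply: le_measure; rewrite ?inE//; first exact: measurableU.
move=> w Yw; have [?|nB] := pselect (B t w); [by left|right].
by apply: YN => /(_ Yw).
Qed.

(** By Egorov's theorem the convergence is uniform off an event of arbitrarily
small probability, and that event then contains all late deviations. *)
Lemma ae_cvg_in_prob (Y : nat -> T -> R) l :
  (forall t, measurable_fun setT (Y t)) ->
  (\forall w \ae P, Y t w @[t --> \oo] --> l) -> cvg_in_prob P Y l.
Proof.
move=> mY Yl e e0.
have mYe t : measurable [set w | e < `|Y t w - l|] by exact: measurable_dev.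
apply/fine_cvgP; split; first by apply: nearW => t; exact: fin_num_measure.
apply/cvgrPdist_lt => eps eps0.
have PT : (P setT < +oo)%E by rewrite probability_setT ltry.
have YlT : \forall w \ae P, setT w -> Y t w @[t --> \oo] --> cst l w.
  by move: Yl; apply: filterS.
have [B [mB Beps uB]] :=
  ae_pointwise_almost_uniform mY (measurable_cst l) measurableT PT YlT eps0.
have nl : nbhs (cst l : {uniform` (setT `\` B) -> R})
    [set h | forall w, (setT `\` B) w -> ball l e (h w)].
  apply/uniform_nbhs; exists [set xy | ball xy.1 e xy.2]; split => //.
  exact: (entourage_ball _ (PosNum e0)).
have : \forall t \near \oo, forall w, (setT `\` B) w -> ball l e (Y t w).
  exact: (uB _ nl).
apply: filterS => t /= tB.
rewrite sub0r normrN ger0_norm ?fine_ge0// -lte_fin fineK ?fin_num_measure//.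
apply: le_lt_trans Beps; apply: le_measure; rewrite ?inE// => w /= Yw.
apply: contrapT => nBw; have := tB w (conj I nBw).
by rewrite /ball/= distrC ltNge (ltW Yw).
Qed.

Lemma chebyshev_cvg_in_prob (Y : nat -> T -> R) l :
  (forall t, measurable_fun setT (Y t)) ->
  (\forall t \near \oo, 'E_P[Y t] = l%:E)%E ->
  'V_P[Y t]%E @[t --> \oo] --> 0%E ->
  cvg_in_prob P Y l.
Proof.
move=> mY EY VY e e0.
apply: (@squeeze_cvge _ _ _ _ (cst 0%E) _ (fun t => (e ^- 2)%:E * 'V_P[Y t])%E).
- move: EY; apply: filterS => t EY.
  rewrite measure_ge0/=.
  pose Z : {RV P >-> R} := mfun_Sub (mem_set (mY t)).
  apply: le_trans (chebyshev Z e0); rewrite /= EY/=.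
  apply: le_measure; rewrite ?inE.
  + exact: measurable_dev.
  + rewrite -[X in measurable X]setTI.
    apply: measurable_fun_ler => //.
    by apply: measurableT_comp => //; exact: measurable_funB.
  + by move=> w /= /ltW.
- exact: cvg_cst.
- by rewrite -(mule0 (e ^- 2)%:E); apply: cvgeZl.
Qed.

End convergence_in_probability.

(** * Moments and measurability *)

Lemma limn_esup_lty_near (R : realType) (u : nat -> \bar R) :
  (limn_esup u < +oo)%E -> \forall k \near \oo, (u k < +oo)%E.
Proof.
rewrite /limn_esup limf_esupE => /ereal_inf_lt[_ [V nV <-] supV].
move: nV; apply: filterS => k Vk; apply: le_lt_trans supV.
by apply: ereal_sup_ubound; exists k.
Qed.

(** Inversion is continuous on the open set of nonzero reals, and a function on
a single point is measurable. *)
Lemma measurable_invr (R : realType) : measurable_fun setT (@GRing.inv R).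
Proof.
have m0 : measurable ([set 0] : set R) by exact: measurable_set1.
have m1 : measurable ([set x | x != 0] : set R) by apply: open_measurable; exact: open_neq.
rewrite (_ : setT = [set 0] `|` [set x | x != 0]); last first.
  apply/seteqP; split=> // x _ /=; by case: (eqVneq x 0) => x0; [left|right].
apply/measurable_funU => //; split; first exact: measurable_fun_set1.
apply: open_continuous_measurable_fun; first exact: open_neq.
by move=> x; rewrite inE; exact: inv_continuous.
Qed.

(** Domination by 1 + Y^4, since y^2 <= 1 + y^4. *)
Lemma integrable_sqr_pow4 d (T : measurableType d) (R : realType)
    (P : probability T R) (Y : T -> R) :
  measurable_fun setT Y -> ('E_P[fun w => (`|Y w| ^+ 4)%R] < +oo)%E ->
  P.-integrable setT (EFin \o (fun w => Y w ^+ 2)).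
Proof.
move=> mY; rewrite unlock => Y4.
have iY4 : P.-integrable setT (EFin \o (fun w => `|Y w| ^+ 4)).
  apply/integrableP; split.
    by apply/measurable_EFinP; apply: measurable_funX; exact: measurableT_comp.
  by under eq_integral do rewrite /= ger0_norm ?exprn_ge0//.
have i1 : P.-integrable setT (EFin \o cst (1 : R)).
  exact: finite_measure_integrable_cst.
apply: le_integrable (integrableD measurableT iY4 i1) => //.
  by apply/measurable_EFinP; exact: measurable_funX.
move=> w _ /=; rewrite lee_fin normrX [leRHS]ger0_norm ?addr_ge0 ?exprn_ge0//.
have := sqr_ge0 (`|Y w| ^+ 2 - 1); have := exprn_ge0 2 (normr_ge0 (Y w)).
by rewrite sqrrB -exprM/=; lra.
Qed.

(** * Batch averages *)

Lemma batch_size_gt0 (m : nat -> nat) t :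
  (forall t, (m t < m t.+1)%N) -> (0 < t)%N -> (0 < batch_size m t)%N.
Proof. by move=> hm; case: t => // t _; rewrite /batch_size subn_gt0. Qed.

Lemma leq_batch_start (m : nat -> nat) t :
  (forall t, (m t < m t.+1)%N) -> (t.-1 <= m t.-1)%N.
Proof. by move=> hm; elim: t.-1 => // s /leq_ltn_trans; apply. Qed.

Section batches.
Context (R : realType) (m : nat -> nat).
Implicit Types (x y : nat -> R) (t : nat).

(** Indexing by k.+1 lets results on families indexed by all of nat apply,
although nothing is known about the value at 0. *)
Lemma batch_avgS x t : batch_avg m x t =
  (batch_size m t)%:R^-1 * \sum_(m t.-1 <= k < m t) x k.+1.
Proof. by rewrite /batch_avg big_add1. Qed.

Lemma batch_avg_lin a x y t :
  batch_avg m (fun k => x k + a * y k) t = batch_avg m x t + a * batch_avg m y t.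
Proof. by rewrite /batch_avg big_split/= -mulr_sumr; ring. Qed.

Lemma batch_avg_cst c t : (0 < batch_size m t)%N -> batch_avg m (fun=> c : R) t = c.
Proof.
move=> t0; rewrite batch_avgS sumr_const_nat -/(batch_size m t) -[c *+ _]mulr_natl mulrA.
by rewrite mulVf ?mul1r// pnatr_eq0 -lt0n.
Qed.

(** Steiner's formula: the cross terms collapse because the deviations are taken
from the average. *)
Lemma sumsq_dev x t : (0 < batch_size m t)%N ->
  \sum_((m t.-1).+1 <= k < (m t).+1) (x k - batch_avg m x t) ^+ 2 =
  (batch_size m t)%:R * (batch_avg m (fun k => x k ^+ 2) t - batch_avg m x t ^+ 2).
Proof.
move=> t0; set a := batch_avg m x t.
have n0 : (batch_size m t)%:R != 0 :> R by rewrite pnatr_eq0 -lt0n.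
rewrite -[LHS](mulVKf n0) -/(batch_avg m (fun k => (x k - a) ^+ 2) t); congr (_ * _).
transitivity (batch_avg m (fun k => x k ^+ 2 + (- (2 * a)) * x k + a ^+ 2 * 1) t).
  by congr (_ * _); apply: eq_bigr => k _; ring.
by rewrite !batch_avg_lin batch_avg_cst// -/a; ring.
Qed.

Lemma measurable_batch_avg d (T : measurableType d) (Z : nat -> T -> R) t :
  (forall k, (0 < k)%N -> measurable_fun setT (Z k)) ->
  measurable_fun setT (fun w => batch_avg m (Z ^~ w) t).
Proof.
move=> mZ; under eq_fun do rewrite batch_avgS.
apply: measurable_funM; first exact: measurable_cst.
by apply: measurable_sum => k; exact: mZ.
Qed.

Lemma expectation_batch_avg d (T : measurableType d) (P : probability T R)
    (Z : nat -> T -> R) mu t : (0 < batch_size m t)%N ->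
  (forall k, (0 < k)%N -> P.-integrable setT (EFin \o Z k)) ->
  (forall k, (0 < k)%N -> (\int[P]_w (Z k w)%:E = mu%:E)%E) ->
  ('E_P[fun w => batch_avg m (Z ^~ w) t] = mu%:E)%E.
Proof.
move=> t0 iZ EZ; rewrite unlock.
under eq_integral do rewrite batch_avgS EFinM -sumEFin.
rewrite integralZl//; last first.
  by apply: integrable_sum => // k _; exact: iZ.
rewrite integral_sum//; last by move=> k; exact: iZ.
under eq_bigr do rewrite EZ//.
by rewrite sumEFin -EFinM -[RHS](congr1 EFin (batch_avg_cst mu t0)) batch_avgS.
Qed.

End batches.

(** * The ratio of the two variances *)

Section ratio.
Context (R : realType).

(** Here q is the empirical second moment, a the batch mean and v the
conditional variance v1. *)
Lemma ratio_identity (n s a mu v q : R) : n - 1 != 0 -> v != 0 ->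
  v = q - s - mu ^+ 2 ->
  (n - 1)^-1 * (n * (q - a ^+ 2)) / v - 1 =
  n / (n - 1) * ((s - 2 * mu * (a - mu) - (a - mu) ^+ 2) / v) + (n - 1)^-1.
Proof.
move=> n1 v0 vE; have qE : q = v + s + mu ^+ 2 by rewrite vE; ring.
by rewrite qE; field; rewrite n1 v0.
Qed.

(** In delta, the bound 1 linearizes D^2 and the other bound leaves e / 2 for the
first summand: the numerator is at most 2 (1 + |mu|) delta, the factor
n / (n - 1) at most 2 and 1 / v at most 2 / c. The bound on n leaves e / 2 for
the second summand. *)
Lemma ratio_bound (n s D mu v c e : R) :
  0 < c -> 0 < e -> 2 <= n -> 2 / e <= n - 1 -> c / 2 <= v ->
  let delta := Num.min 1 (c * e / (16 * (1 + `|mu|))) in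
  `|s| <= delta -> `|D| <= delta ->
  `|n / (n - 1) * ((s - 2 * mu * D - D ^+ 2) / v) + (n - 1)^-1| <= e.
Proof.
move=> c0 e0 n2 ne cv delta sd Dd.
have mu0 : 0 < 1 + `|mu| by rewrite ltr_pwDl.
have d1 : delta <= 1 by rewrite ge_min lexx.
have dE : delta * (16 * (1 + `|mu|)) <= c * e.
  by rewrite -ler_pdivlMr ?mulr_gt0// ge_min lexx orbT.
have d0 : 0 <= delta by rewrite (le_trans _ sd).
have n1 : 1 <= n - 1 by lra.
have v0 : 0 < v by apply: lt_le_trans cv; rewrite divr_gt0.
have num : `|s - 2 * mu * D - D ^+ 2| <= delta * (2 * (1 + `|mu|)).
  apply: le_trans (ler_normB _ _) _; rewrite normrX.
  apply: (@le_trans _ _ (`|s| + 2 * `|mu| * `|D| + `|D| ^+ 2)).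
    rewrite lerD2r; apply: le_trans (ler_normB _ _) _.
    by rewrite !normrM ger0_norm.
  have : `|D| ^+ 2 <= delta.
    rewrite expr2; apply: le_trans (ler_pM _ _ Dd (le_trans Dd d1)) _ => //.
    by rewrite mulr1.
  have : `|mu| * `|D| <= `|mu| * delta by rewrite ler_wpM2l.
  by move: sd; lra.
have nn : n / (n - 1) <= 2 by rewrite ler_pdivrMr; lra.
have nn0 : 0 <= n / (n - 1) by rewrite divr_ge0; lra.
have numv : `|s - 2 * mu * D - D ^+ 2| / v <= e / 4.
  rewrite ler_pdivrMr// (le_trans num)//.
  have : e / 4 * (c / 2) <= e / 4 * v by rewrite ler_wpM2l// divr_ge0// ltW.
  by lra.
have ninv : (n - 1)^-1 <= e / 2.
  by rewrite -[leRHS]invrK lef_pV2 ?posrE ?invr_gt0 ?divr_gt0 ?invf_div//; lra.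
have ninv0 : 0 <= (n - 1)^-1 by rewrite invr_ge0; lra.
apply: le_trans (ler_normD _ _) _; rewrite (ger0_norm ninv0) normrM (ger0_norm nn0).
rewrite normrM (@ger0_norm _ v^-1) ?invr_ge0 ?(ltW v0)//.
have -> : e = 2 * (e / 4) + e / 2 by field.
by apply: lerD => //; apply: ler_pM => //; rewrite divr_ge0// ltW.
Qed.

End ratio.

(** * The three variances of a batch *)

(** The upper bound also makes v0 finite, so that it agrees with its [fine] part;
a positive infimum alone would allow infinite variances. *)
Lemma v0sq_bounds (d : measure_display) (T : measurableType d) (R : realType)
  (P : probability T R) (X : nat -> T -> R) (m : nat -> nat) :
  (0 < ereal_inf [set v0sq P X m t | t in [set t | (0 < t)%N]])%E ->
  (ereal_sup [set v0sq P X m t | t in [set t | (0 < t)%N]] < +oo)%E ->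
  exists c C : R, 0 < c /\
  forall t, (0 < t)%N -> (c%:E <= v0sq P X m t <= C%:E)%E.
Proof.
set lo := ereal_inf _ => lo0; set hi := ereal_sup _ => hioo.
have lov t : (0 < t)%N -> (lo <= v0sq P X m t)%E.
  by move=> t0; apply: ereal_inf_lbound; exists t.
have vhi t : (0 < t)%N -> (v0sq P X m t <= hi)%E.
  by move=> t0; apply: ereal_sup_ubound; exists t.
have lohi : (lo <= hi)%E by exact: le_trans (lov 1%N isT) (vhi 1%N isT).
have lofin : lo \is a fin_num by rewrite gt0_fin_numE// (le_lt_trans lohi).
have hifin : hi \is a fin_num by rewrite gt0_fin_numE// (lt_le_trans lo0).
exists (fine lo), (fine hi); split; first by rewrite fine_gt0// lo0 ltey_eq lofin.
by move=> t t0; rewrite !fineK// lov//= vhi.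
Qed.

(** Chebyshev: the batch mean has expectation mu and variance v0 / n <= C / n. *)
Lemma batch_mean_cvg_in_prob (d : measure_display) (T : measurableType d)
  (R : realType) (P : probability T R) (F : nat -> set (set T))
  (X : nat -> T -> R) (mu C : R) (m : nat -> nat) :
  is_filtration P F ->
  (forall t, (m t < m t.+1)%N) ->
  (forall k, (0 < k)%N -> measurable_fun setT (X k)) ->
  (forall k, (0 < k)%N -> P.-integrable setT (EFin \o X k)) ->
  (forall k, (0 < k)%N -> \forall w \ae P, condexp P (F k.-1) (X k) w = mu) ->
  batch_size m t @[t --> \oo] --> \oo ->
  (forall t, (0 < t)%N -> (v0sq P X m t <= C%:E)%E) ->
  cvg_in_prob P (batch_mean X m) mu.
Proof.
move=> [_ sF FT _] hm mX iX Xmu hsize vC.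
have n0 t : (0 < t)%N -> (0 < batch_size m t)%N by exact: batch_size_gt0.
have EX k : (0 < k)%N -> (\int[P]_w (X k w)%:E = mu%:E)%E.
  move=> k0; rewrite -(condexp_int (sF k.-1) (FT k.-1) (iX k k0)).
  transitivity (\int[P]_w (cst mu%:E) w)%E; last first.
    by rewrite integral_cst// [X in (_ * X)%E]probability_setT mule1.
  apply: ae_eq_integral => //.
  - by apply/measurable_EFinP; exact: condexp_measurable.
  - by move: (Xmu k k0); apply: filterS => w ->.
apply: chebyshev_cvg_in_prob.
- by move=> t; exact: measurable_batch_avg.
- by exists 1%N => // t /= t0; apply: expectation_batch_avg => //; exact: n0.
apply: (@squeeze_cvge _ _ _ _ (cst 0%E) _
    (fun t => ((batch_size m t)%:R^-1 * C)%:E)).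
- exists 1%N => // t /= t0; rewrite variance_ge0/= EFinM lee_pdivlMl ?ltr0n ?n0//.
  exact: vC.
- exact: cvg_cst.
- apply: cvg_EFin; first exact: nearW.
  rewrite -(mul0r C); apply: cvgMl.
  apply/gtr0_cvgV0; last exact/cvgrnyP.
  by exists 1%N => // t /= t0; rewrite ltr0n n0.
Qed.

(** Only large t are covered, because [condvarE] needs X_k^2 to be integrable for
every k of the batch, and a batch t starts after index t - 1. *)
Lemma v1sqE_ae (d : measure_display) (T : measurableType d)
  (R : realType) (P : probability T R) (F : nat -> set (set T))
  (X : nat -> T -> R) (mu : R) (m : nat -> nat) :
  is_filtration P F ->
  (forall t, (m t < m t.+1)%N) ->
  (forall k, (0 < k)%N -> P.-integrable setT (EFin \o X k)) ->
  (forall k, (0 < k)%N -> \forall w \ae P, condexp P (F k.-1) (X k) w = mu) ->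
  (\forall k \near \oo, P.-integrable setT (EFin \o (fun w => X k w ^+ 2))) ->
  \forall t \near \oo, \forall w \ae P,
    v1sq P F X m t w = batch_avg m (fun k => X k w ^+ 2) t -
      batch_avg m (fun k =>
        X k w ^+ 2 - condexp P (F k.-1) (fun w' => X k w' ^+ 2) w) t - mu ^+ 2.
Proof.
move=> [_ sF FT _] hm iX Xmu [K _ iX2].
have cv : \forall w \ae P, forall k, (K < k)%N ->
    condvar P (F k.-1) (X k) w =
    condexp P (F k.-1) (fun w' => X k w' ^+ 2) w - mu ^+ 2.
  apply: ae_foralln => k; have [kK|kK] := ltnP K k; last by apply: aeW.
  have k0 : (0 < k)%N by rewrite (leq_ltn_trans _ kK).
  have := condvarE (sF k.-1) (FT k.-1) (iX k k0) (iX2 k (ltnW kK)) (Xmu k k0).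
  by apply: filterS => w ->.
exists K.+1 => // t /= Kt; move: cv; apply: filterS => w cv.
have t0 : (0 < batch_size m t)%N.
  by apply: batch_size_gt0 => //; exact: leq_trans Kt.
transitivity (batch_avg m (fun k => X k w ^+ 2 + (-1) *
    (X k w ^+ 2 - condexp P (F k.-1) (fun w' => X k w' ^+ 2) w) +
    (- mu ^+ 2) * 1) t).
  congr (_ * _); apply: eq_big_nat => k /andP[km _].
  rewrite cv; first by ring.
  rewrite (leq_ltn_trans _ km)// (leq_trans _ (leq_batch_start t hm))//.
  by rewrite -ltnS prednK// (leq_trans _ Kt).
by rewrite !batch_avg_lin batch_avg_cst//; ring.
Qed.

(** * Consistency of the empirical variance *)

Unset Implicit Arguments.

Theorem theorem4p6 (d : measure_display) (T : measurableType d) (R : realType)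
  (P : probability T R) (F : nat -> set (set T)) (X : nat -> T -> R) (mu : R)
  (m : nat -> nat)
  (hF : is_filtration P F)
  (hm0 : m 0%N = 0%N)
  (hm : forall t, (m t < m t.+1)%N)
  (hXF : forall k, (0 < k)%N -> measurable_wrt (F k) (X k))
  (hXint : forall k, (0 < k)%N -> P.-integrable setT (EFin \o X k))
  (hXmu : forall k, (0 < k)%N ->
    \forall w \ae P, condexp P (F k.-1) (X k) w = mu)
  (hsize : batch_size m t @[t --> \oo] --> \oo)
  (hv0_inf : (0 < ereal_inf [set v0sq P X m t | t in [set t | (0 < t)%N]])%E)
  (hv0_sup : (ereal_sup [set v0sq P X m t | t in [set t | (0 < t)%N]] < +oo)%E)
  (hv0_equiv :
    (fine (v0sq P X m t.+1) / (batch_size m t.+1)%:R) /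
    (fine (v0sq P X m t) / (batch_size m t)%:R) @[t --> \oo] --> (1 : R))
  (hv1_inf : \forall w \ae P,
    (0 < ereal_inf [set (v1sq P F X m t w)%:E | t in [set t | (0 < t)%N]])%E)
  (hv1_sup : \forall w \ae P,
    (ereal_sup [set (v1sq P F X m t w)%:E | t in [set t | (0 < t)%N]] < +oo)%E)
  (hv1v0 : cvg_in_prob P
    (fun t w => v1sq P F X m t w / fine (v0sq P X m t)) 1)
  (hlindeberg : forall eta : R, 0 < eta ->
    cvg_in_prob P
      (fun t w => batch_avg m
        (fun k => condexp P (F k.-1)
          (fun w' => `|X k w' - mu| ^+ 2 *
             \1_[set w'' | eta * Num.sqrt (batch_size m t)%:R
                             < `|X k w'' - mu|] w') w) t) 0)
  (hX4 : (limn_esup (fun k => 'E_P[fun w => (`|X k w| ^+ 4)%R]) < +oo)%E)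
  (hX2 : \forall w \ae P,
    batch_avg m
      (fun k => X k w ^+ 2 - condexp P (F k.-1) (fun w' => X k w' ^+ 2) w) t
      @[t --> \oo] --> (0 : R)) :
  cvg_in_prob P (fun t w => v2sq X m t w / v1sq P F X m t w) 1.
Proof.
have [_ sF FT _] := hF.
have n0 t : (0 < t)%N -> (0 < batch_size m t)%N by exact: batch_size_gt0.
have mX k : (0 < k)%N -> measurable_fun setT (X k).
  by move=> k0; exact (measurable_wrt_sub (sF k) (FT k) (hXF k k0)).
have mce k Y : measurable_fun setT (condexp P (F k) Y) by exact: condexp_measurable.
have mv1 t : measurable_fun setT (v1sq P F X m t).
  by apply: measurable_batch_avg => k _; exact: mce.
have mmean t : measurable_fun setT (batch_mean X m t).
  exact: measurable_batch_avg.
have mv2 t : measurable_fun setT (v2sq X m t).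
  apply: measurable_funM; first exact: measurable_cst.
  under eq_fun do rewrite big_add1.
  apply: measurable_sum => k; apply: measurable_funX; apply: measurable_funB => //.
  exact: mX.
have [c [C [c0 v0]]] := v0sq_bounds hv0_inf hv0_sup.
have v0C t : (0 < t)%N -> (v0sq P X m t <= C%:E)%E by move=> /v0/andP[].
have cv0 t : (0 < t)%N -> c <= fine (v0sq P X m t).
  move=> /v0/andP[cv vC]; rewrite -lee_fin fineK//.
  by rewrite fin_numElt (lt_le_trans (ltNyr c) cv) (le_lt_trans vC (ltry C)).
have meancvg := batch_mean_cvg_in_prob hF hm mX hXint hXmu hsize v0C.
pose S t w := batch_avg m
  (fun k => X k w ^+ 2 - condexp P (F k.-1) (fun w' => X k w' ^+ 2) w) t.
have mS t : measurable_fun setT (S t).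
  apply: measurable_batch_avg => k k0; apply: measurable_funB; last exact: mce.
  by apply: measurable_funX; exact: mX.
have Scvg : cvg_in_prob P S 0 by exact: ae_cvg_in_prob.
have iX2 : \forall k \near \oo, P.-integrable setT (EFin \o (fun w => X k w ^+ 2)).
  have [K _ X4] := limn_esup_lty_near hX4.
  exists K.+1 => // k /= Kk; apply: integrable_sqr_pow4.
    by apply: mX; exact: leq_trans Kk.
  exact: X4 (ltnW Kk).
have v1E := v1sqE_ae hF hm hXint hXmu iX2.
apply: cvg_in_prob_ae_sub.
  move=> t; apply: measurable_funM => //.
  exact: measurableT_comp (@measurable_invr R) (mv1 t).
move=> e e0; pose delta := Num.min 1 (c * e / (16 * (1 + `|mu|))).
have delta0 : 0 < delta.
  by rewrite lt_min ltr01 divr_gt0 ?mulr_gt0 ?ltr_pwDl.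
(* Off these three events S and D are at most delta and v1 is at least v0 / 2. *)
exists (fun t => [set w | delta < `|S t w - 0|] `|`
  [set w | delta < `|batch_mean X m t w - mu|] `|`
  [set w | 2^-1 < `|v1sq P F X m t w / fine (v0sq P X m t) - 1|]).
have mv10 t : measurable_fun setT (fun w => v1sq P F X m t w / fine (v0sq P X m t)).
  exact: measurable_funM.
split.
- by move=> t; apply: measurableU; [apply: measurableU|]; exact: measurable_dev.
- apply: cvg_prob_setU.
  + by move=> t; apply: measurableU; exact: measurable_dev.
  + by move=> t; exact: measurable_dev.
  + apply: cvg_prob_setU; [by move=> t; exact: measurable_dev..| |].
    * exact: Scvg.
    * exact: meancvg.
  + by apply: hv1v0; rewrite invr_gt0.
(* The thresholds on the batch size that [ratio_bound] asks for. *)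
have nlarge : \forall t \near \oo, Num.max 2 (2 / e + 1) <= (batch_size m t)%:R :> R.
  exact: (cvgryPge _).1 ((cvgrnyP (R := R) _).2 hsize) _.
near=> t.
have t0 : (0 < t)%N by near: t; exact: nbhs_infty_gt.
have : Num.max 2 (2 / e + 1) <= (batch_size m t)%:R :> R by near: t.
rewrite ge_max => /andP[n2 ne].
have : \forall w \ae P, v1sq P F X m t w =
  batch_avg m (fun k => X k w ^+ 2) t - S t w - mu ^+ 2 by near: t.
apply: filterS => w v1tE; apply: contraPP => /not_orP[/not_orP[/negP nS /negP nD] /negP nv].
apply/negP; move: nS nD nv; rewrite -!leNgt subr0 => Sd Dd vd.
set v := v1sq P F X m t w in v1tE vd *.
have v0t := cv0 t t0; have v0gt : 0 < fine (v0sq P X m t) by exact: lt_le_trans v0t.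
have vc : c / 2 <= v.
  move: vd; rewrite ler_distl => /andP[vd _].
  have : 2^-1 * fine (v0sq P X m t) <= v by rewrite -ler_pdivlMr//; lra.
  by lra.
have vgt0 : 0 < v by apply: lt_le_trans vc; rewrite divr_gt0.
rewrite /v2sq sumsq_dev ?n0// -/(batch_mean X m t w).
rewrite (@ratio_identity _ _ (S t w) _ mu) ?gt_eqF//; last by rewrite subr_gt0; lra.
by apply: (@ratio_bound _ _ _ _ _ _ c) => //; lra.
Unshelve. all: end_near.
Qed.
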